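(* Let $q$ be a prime power, $n$ a positive integer, $0<t\le n$ an integer and $b=1+q^t$, and assume that the polynomial $\mathrm{Tr}(X)=\mathrm{Tr}_b(X)$ has $m=q^{2n-1-t}+q^{2n-1}$ different roots $\beta_1,\dots,\beta_m$ in $\mathbb{F}_{q^{2n}}$. For $1\le i\le q^{2n}-1$ let $s_i=\sum_{j=1}^m \beta_j^i$. Indices $i$ below are integers with $1\le i\le m$. (1) Suppose $1<t<n$. Then there are exactly $q$ indices $i\le m$ such that $s_i\neq 0$. Denote them in increasing order by $i_0<i_1$ if $q=2$, and by $i_0<i_1<i_{2,0}<i_{2,1}<\cdots<i_{2,q-3}$ if $q>2$. Then: a) $i_0=m-k_1$, $i_1=m-(k_1+k_t-m)$, and $i_{2,\ell}=m-j_{2,\ell}$ for $0\le \ell\le q-3$. b) $s_{i_0}=1$, and $s_{i_{2,\ell}}=1$ for every even $\ell$ (including $\ell=0$) with $0\le\ell\le q-3$. c) $s_{i_1}=-1$, and $s_{i_{2,\ell}}=-1$ for every odd $\ell$ with $0\le \ell\le q-3$. (2) Suppose $t=1<n$ and $(q,n)\ne(2,2)$. Then there are exactly $q+1$ indices $i\le m$ such that $s_i\ne0$. In increasing order they are $$i_0<i_1<i_{2,0}<i_{2,1}<\cdots<i_{2,q-3}<i_{2,q-2},\qquad i_{2,q-2}:=i_{2,q-3}+q^{2n-2}-q^{2n-3}+q-1,$$ where, when $q=2$, the list is $i_0<i_1<i_{2,0}$ and $i_{2,q-3}=i_{2,-1}$ is read as $i_1$. They satisfy $i_0=m-k_1$,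 $i_1=m-(k_1+k_t-m)$ and $i_{2,\ell}=m-j_{2,\ell}$ for $0\le\ell\le q-3$; moreover $s_{i_0}=1$, $s_{i_1}=-1$, and for $0\le \ell\le q-2$ one has $s_{i_{2,\ell}}=1$ if $\ell$ is even and $s_{i_{2,\ell}}=-1$ if $\ell$ is odd. (2') If $q=2$, $n=2$, $t=1$, there are exactly four indices $i_0<i_1<i_{2,0}<i_{2,1}$ that are at most $m$ and satisfy $s_i\neq0$; they are $i_0=m-k_1$, $i_1=m-(k_1+k_t-m)$, $i_{2,\ell}=m-j_{2,\ell}$ for $\ell=0,1$, and $s_{i_0}=s_{i_{2,0}}=1$, $s_{i_1}=s_{i_{2,1}}=-1$. (3) Suppose $t=n$ and $(q,n)\neq(2,2)$. Then there is only one index $i\le m$ such that $s_{i}\ne 0$, namely $i_0=q^{2n-1}-q^n+q^{n-1}-1$. If $q=t=n=2$, there are exactly two indices $i\le m$ with $s_i\neq 0$, namely $i_0=5$ and $i_1=10$.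
   Context: For a positive integer $j$ put $\mathrm{tr}_j(X)=X+X^q+\cdots+X^{q^{j-1}}$. For $b=1+q^t$ with $0<t\le n$, let $P_b(X)=1+\mathrm{tr}_{2n}(X^b)$ if $0<t<n$, and $P_b(X)=1+\mathrm{tr}_n(X^b)$ if $t=n$. The $b$th trace-depending polynomial $\mathrm{Tr}_b(X)\in\mathbb{F}_{q^{2n}}[X]$ is the representative of minimum degree of the class of $P_b(X)$ in $\mathbb{F}_{q^{2n}}[X]/\langle X^{q^{2n}-1}-1\rangle$. Notation: $m=q^{2n-1-t}+q^{2n-1}$; for $t<n$ and $1\le j\le t$, $k_j=q^{j-1}(1+q^{2n-t})$ (so $k_1=1+q^{2n-t}$ and $k_t=q^{t-1}+q^{2n-1}$); and for $0\le \ell\le q-1$, $j_{2,\ell}=1+(2+\ell)q^{t-1}+(q-(2+\ell))q^{2n-t-1}$. The values $s_i$ lie in $\mathbb{F}_{q^{2n}}$, and $1,-1$ denote elements of that field (so $1=-1$ in characteristic 2).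
   Formalization: In part (3) the value of i_0 is asserted only for n>1 (for n=t=1 it would be 0, not an index; for q>2 the only index is q+1), while uniqueness is kept; the β_j are all the roots of Tr, which excludes q=2, n=t=1, where Tr=0 has 4 roots. *)

(* Defs.v *)
From mathcomp Require Import all_boot all_order all_algebra.

Set Implicit Arguments.
Unset Strict Implicit.
Unset Printing Implicit Defensive.

Import GRing.Theory.

Local Open Scope ring_scope.

Definition tr_poly (F : fieldType) (q j : nat) : {poly F} :=
  \sum_(i < j) 'X^(q ^ i).

(* P_b for b = 1 + q ^ t; t <= n is intended, so the else branch is t = n. *)
Definition Pb (F : fieldType) (q n t : nat) : {poly F} :=
  1 + ((tr_poly F q (if (t < n)%N then (2 * n)%N else n)) \Po 'X^(1 + q ^ t)).

Definition Trb (F : fieldType) (q n t : nat) : {poly F} :=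
  Pb F q n t %% ('X^(q ^ (2 * n) - 1) - 1).

(* The remainder used in Trb is the representative of minimum degree of its
   residue class, and the only one of that degree. *)
Lemma modp_min_repr (F : fieldType) (P D : {poly F}) :
  D %| P %% D - P /\
  (forall Q : {poly F}, D %| Q - P -> Q != P %% D ->
     (size (P %% D)%R < size Q)%N).
Proof.
have DP : D %| P %% D - P.
  by apply/modp_eq0P; rewrite modpD modpN modp_id subrr.
split=> // Q /modp_eq0P DQ neQ.
have eQ : Q %% D = P %% D by apply/eqP; rewrite -subr_eq0 -modpN -modpD DQ.
rewrite -eQ in neQ *; have [D0|D0] := eqVneq D 0.
  by move: neQ; rewrite D0 modp0 eqxx.
apply: leq_trans (ltn_modpN0 Q D0) _.
by rewrite leqNgt; apply: contra neQ => /modp_small->.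
Qed.

(* The exponents are exact (no truncation) for 0 < t <= n. *)
Definition mdeg (q n t : nat) : nat := q ^ (2 * n - 1 - t) + q ^ (2 * n - 1).

Definition kidx (q n t j : nat) : nat := q ^ (j - 1) * (1 + q ^ (2 * n - t)).

(* Integer-valued, because q - (2 + l) may be negative. *)
Definition j2 (q n t l : nat) : int :=
  1 + (2 + l)%:Z * q%:Z ^+ (t - 1)
    + (q%:Z - (2 + l)%:Z) * q%:Z ^+ (2 * n - t - 1).

Definition power_sum (F : fieldType) (m : nat) (beta : m.-tuple F) (i : nat) : F :=
  \sum_(j < m) tnth beta j ^+ i.

(* The indices 1 <= i <= m with a nonzero power sum, in increasing order. *)
Definition nz_indices (F : fieldType) (m : nat) (beta : m.-tuple F) : seq nat :=
  [seq i <- iota 1 m | power_sum beta i != 0].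

Lemma nz_indices_sorted (F : fieldType) (m : nat) (beta : m.-tuple F) :
  sorted ltn (nz_indices beta).
Proof. by apply: sorted_filter (iota_ltn_sorted 1 m); apply: ltn_trans. Qed.

Lemma mem_nz_indices (F : fieldType) (m : nat) (beta : m.-tuple F) (i : nat) :
  (i \in nz_indices beta) = [&& (0 < i)%N, (i <= m)%N & power_sum beta i != 0].
Proof. by rewrite mem_filter mem_iota add1n ltnS andbC -andbA. Qed.

(* Main.v *)
(* Let R be the reversal of Tr_b, that is the product of the 1 - beta_j X, and
   let S be the sum of the s_i X^i for 1 <= i <= m.  Newton's identities say
   R S = - X R' modulo X^(m+1), and since R is invertible there it suffices to
   guess a truncated series G with R G = - X R' and to read off its coefficients.
   Put u = 2n - t, d = m - k_t and i0 = m - k_1.  In characteristic p only the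
   exponents of Tr_b prime to p survive in X R': if t < n, then
   - X R' = X^i0 + X^(i0 + q d), while R = 1 + X^d + E.  As
   (1 + X^d) (1 - X^d + ... + (-1)^(q-1) X^((q-1) d)) = 1 + X^(q d),
   G = X^i0 (1 - X^d + ... ) works when X^i0 E vanishes modulo X^(m+1), i.e. for
   t >= 2.  For t = 1 one monomial X^k of E survives and contributes the extra
   term - X^(i0 + k).  For t = n > 1, G = X^i0. *)
Require Import Defs.
From mathcomp Require Import all_boot all_order all_algebra finfield.
From mathcomp Require Import ring zify.

Set Implicit Arguments.
Unset Strict Implicit.
Unset Printing Implicit Defensive.

Import GRing.Theory.

(** * Inequalities between exponents *)

(** With [b] = k_1 and [c] an exponent of Tr_b, the monomial X^(m - c) of R is pushed beyond degree
    m when multiplied by X^i0. *)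
Lemma shift_gap m b c : c + b < m -> m < m - b + (m - c).
Proof. lia. Qed.

Lemma subnS_addn a b c : a <= b -> 1 + b < c ->
  c - (1 + b) + (b - a) = c - (1 + a).
Proof. lia. Qed.

Lemma expn_pred q k : 0 < k -> q ^ k = q * q ^ k.-1.
Proof. by case: k => // k _; rewrite expnS. Qed.

Lemma leq_expn_mull q j k c : 0 < q -> j <= k -> q ^ j * c <= q ^ k * c.
Proof. by move=> q_gt0 le_jk; rewrite leq_mul2r leq_pexp2l ?orbT. Qed.

(** Hypothesis of [shift_gap] for the second largest exponent, j = u-2, of the first sum in Tr_b;
    here [x] = q^(u-2) and [y] = q^(t-1). *)
Lemma gap_top q x y : 1 < q -> 1 < x -> q <= y ->
  x * (1 + q * y) + (1 + q * (q * x)) < q * x + q * (q * x) * y.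
Proof.
move=> q_gt1 x_gt1 le_qy.
have : 2 * x <= q * x by rewrite leq_mul2r q_gt1 orbT.
have : 2 * (x * (q * y)) <= q * (x * (q * y)) by rewrite leq_mul2r q_gt1 orbT.
have : q * (q * x) <= x * (q * y).
  by rewrite mulnA mulnC leq_mul2l leq_mul2l le_qy !orbT.
have -> : q * (q * x) * y = q * (x * (q * y)) by lia.
by rewrite mulnDr muln1; lia.
Qed.

(** Likewise for the second sum, whose critical exponent has j = t-2; here [x] = q^(u-2) and [y] =
    q^(t-2). *)
Lemma gap_bottom q x y : 1 < q -> 0 < y < x ->
  y * (1 + q * (q * x)) + (1 + q * (q * x)) < q * x + q * (q * x) * (q * y).
Proof.
move=> q_gt1 /andP[y_gt0 lt_yx].
have : 2 * x <= q * x by rewrite leq_mul2r q_gt1 orbT.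
have : q * (q * x) <= y * (q * (q * x)) by rewrite leq_pmull.
have : 2 * (y * (q * (q * x))) <= q * (y * (q * (q * x))).
  by rewrite leq_mul2r q_gt1 orbT.
have -> : q * (q * x) * (q * y) = q * (y * (q * (q * x))) by lia.
by rewrite mulnDr muln1; lia.
Qed.

(** For [x] = q^(u-1) and [y] = q^(t-1) this is k_1 < m, so that i0 = m - k_1 is positive. *)
Lemma gap_all q x y : 0 < q -> 0 < y < x -> 1 + q * x < x + q * x * y.
Proof.
move=> q_gt0 /andP[y_gt0 lt_yx].
have : q * x <= q * x * y by rewrite leq_pmulr.
lia.
Qed.

(* For t >= 2, all exponents of R but 0 and d exceed m when shifted by i0. *)
Lemma off_gaps q n t (u := 2 * n - t) (x := q ^ u.-1) (y := q ^ t.-1)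
    (m := x + q * x * y) (i0 := m - (1 + q * x)) :
  1 < q -> 1 < t < n ->
  [/\ m < i0 + m,
      forall j, j < u.-1 -> m < i0 + (m - q ^ j * (1 + q ^ t)),
      forall j, j < t.-1 -> m < i0 + (m - q ^ j * (1 + q ^ u))
    & i0 + q.-1 * (x - y) <= m].
Proof.
move=> q_gt1 /andP[t_gt1 lt_tn]; have q_gt0 := ltnW q_gt1.
have u_gt1 : 1 < u by rewrite /u; lia.
have lt_tu : t.-2 < u.-2 by rewrite /u; lia.
have xE : x = q * q ^ u.-2 by rewrite /x expn_pred // -subn1 subn_gt0.
have yE : y = q * q ^ t.-2 by rewrite /y expn_pred // -subn1 subn_gt0.
have y'_gt0 : 0 < q ^ t.-2 by rewrite expn_gt0 q_gt0.
have lt_y'x' : q ^ t.-2 < q ^ u.-2 by rewrite ltn_exp2l.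
have lt_yx : y < x by rewrite xE yE ltn_pmul2l.
have y_gt0 : 0 < y by rewrite expn_gt0 q_gt0.
have lt_k1 : 1 + q * x < m by apply: gap_all; rewrite // y_gt0.
split=> [|j lt_j|j lt_j|].
- by rewrite -[X in X < _]add0n ltn_add2r subn_gt0.
- apply: shift_gap; rewrite (expn_pred q (ltnW t_gt1)) -/y.
  have le_j : q ^ j * (1 + q * y) <= q ^ u.-2 * (1 + q * y).
    by apply: leq_expn_mull; rewrite // -ltnS prednK // -subn1 subn_gt0.
  apply: (leq_ltn_trans (n := q ^ u.-2 * (1 + q * y) + (1 + q * x))).
    by rewrite leq_add2r.
  rewrite /m xE; apply: gap_top => //.
    by rewrite (leq_ltn_trans y'_gt0).
  by rewrite yE leq_pmulr.
- apply: shift_gap; rewrite (expn_pred q (ltnW u_gt1)) -/x.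
  have le_j : q ^ j * (1 + q * x) <= q ^ t.-2 * (1 + q * x).
    by apply: leq_expn_mull; rewrite // -ltnS prednK // -subn1 subn_gt0.
  apply: (leq_ltn_trans (n := q ^ t.-2 * (1 + q * x) + (1 + q * x))).
    by rewrite leq_add2r.
  by rewrite /m yE xE; apply: gap_bottom; rewrite // y'_gt0.
have le_qxy : q.-1 * (x - y) <= q * x.
  by apply: leq_mul; rewrite ?leq_pred ?leq_subr.
by rewrite -(subnK (ltnW lt_k1)) leq_add2l (leq_trans le_qxy) // leq_addl.
Qed.

(* For t = 1, where d = x - 1, the same holds of the exponents but 0, d and k. *)
Lemma one_gaps q n (u := 2 * n - 1) (x := q ^ u.-1) (m := x + q * x)
    (i0 := m - (1 + q * x)) (k := m - q ^ u.-2 * (1 + q)) :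
  1 < q -> 1 < n -> (q, n) <> (2, 2) ->
  [/\ m < i0 + m,
      forall j, j < u.-2 -> m < i0 + (m - q ^ j * (1 + q)),
      q.-1 * (x - 1) < k,
      x - 1 <= k
    & i0 + k <= m < i0 + k + (x - 1)].
Proof.
move=> q_gt1 n_gt1 qn; have q_gt0 := ltnW q_gt1.
pose z := q ^ u.-2.-1.
have lt_n : 2 < u by rewrite /u; lia.
have z_gt0 : 0 < z by rewrite expn_gt0 q_gt0.
have zE : q ^ u.-2 = q * z by rewrite expn_pred // -subn2 subn_gt0.
have xE : x = q * (q * z) by rewrite -zE /x expn_pred // -subn1 subn_gt0 ltnW.
(* As [z] = q^(2n-4), the excluded pair (2, 2) is exactly q = 2, [z] = 1, where [big_gap] would read
   4 < 4. *)
have q2z : 3 <= q \/ 2 <= z.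
  have [q_gt2|q_le2] := ltnP 2 q; first by left.
  right; rewrite -[2](expn1 2) /z; have -> : q = 2 by lia.
  rewrite leq_exp2l // /u; move: qn; have -> : q = 2 by lia.
  by case: (n =P 2) => [->|n2 _] //; lia.
have qz : 2 * z <= q * z by rewrite leq_mul2r q_gt1 orbT.
have qqz : 2 * (q * z) <= q * (q * z) by rewrite leq_mul2r q_gt1 orbT.
have qqqz : 2 * (q * (q * z)) <= q * (q * (q * z)).
  by rewrite leq_mul2r q_gt1 orbT.
have big_gap : z + q * z + 1 < q * (q * z).
  case: q2z => [q_gt2|z_gt1]; last by lia.
  have : 3 * z <= q * z by rewrite leq_mul2r q_gt2 orbT.
  lia.
have mE : m = q * (q * z) + q * (q * (q * z)) by rewrite /m xE.
have kE : k = q * (q * (q * z)) - q * z.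
  by rewrite /k mE zE mulnDr muln1 (mulnC _ q); lia.
split=> [|j lt_j|||].
- by rewrite /i0 mE xE; lia.
- apply: shift_gap.
  have : q ^ j * (1 + q) <= z * (1 + q).
    apply: leq_expn_mull => //; move: lt_j; case: (u.-2) => // v; exact.
  by rewrite mulnDr muln1 (mulnC z) mE xE; lia.
- apply: (leq_ltn_trans (n := q * x - x)).
    have -> : q * x - x = (q - 1) * x by rewrite mulnBl mul1n.
    by rewrite -(subn1 q) leq_mul2l leq_subr orbT.
  by rewrite kE xE; lia.
- by rewrite kE xE; lia.
by rewrite kE /i0 mE xE; lia.
Qed.

(** The decisive exponent is the one with j = n-2. The inequality [gap] amounts to z + 1 < q z with
    z = q^(n-2), which becomes an equality exactly at (2, 2). *)
Lemma diag_gaps q n (m := q ^ n.-1 * (1 + q ^ n)) (i0 := m - (1 + q ^ n)) :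
  1 < q -> 1 < n -> (q, n) <> (2, 2) ->
  [/\ 0 < i0 <= m, m < i0 + m
    & forall j, j < n.-1 -> m < i0 + (m - q ^ j * (1 + q ^ n))].
Proof.
move=> q_gt1 n_gt1 qn; have q_gt0 := ltnW q_gt1.
pose z := q ^ n.-2; set c := (1 + q ^ n) in m i0 *.
have z_gt0 : 0 < z by rewrite expn_gt0 q_gt0.
have c_gt0 : 0 < c by [].
have mE : m = q * z * c.
  by rewrite /m expn_pred // -subn1 subn_gt0.
have q2z : 3 <= q \/ 2 <= z.
  have [q_gt2|q_le2] := ltnP 2 q; first by left.
  right; rewrite -[2](expn1 2) /z; have -> : q = 2 by lia.
  rewrite leq_exp2l //; move: qn; have -> : q = 2 by lia.
  by case: (n =P 2) => [->|n2 _] //; lia.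
have gap : z * c + c < m.
  rewrite mE -{2}[c]mul1n -mulnDl ltn_mul2r c_gt0 /=.
  case: q2z => [q_gt2|z_gt1].
    have : 3 * z <= q * z by rewrite leq_mul2r q_gt2 orbT.
    lia.
  have : 2 * z <= q * z by rewrite leq_mul2r q_gt1 orbT.
  lia.
split=> [||j lt_j].
- by rewrite leq_subr subn_gt0 (leq_ltn_trans _ gap) // leq_addl.
- by rewrite -[X in X < _]add0n ltn_add2r subn_gt0 (leq_ltn_trans _ gap) // leq_addl.
apply: shift_gap; apply: leq_ltn_trans gap; rewrite leq_add2r.
by apply: leq_expn_mull => //; move: lt_j; case: (n.-1).
Qed.

Local Open Scope ring_scope.

(** * Newton's identities for the reversed polynomial *)

Section Reversal.
Variable F : fieldType.
Implicit Types (A B : {poly F}) (s : seq F).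

(** This is X^m A(1/X), with [m] fixed independently of the degree of [A]: reversal is then additive
    and can be computed monomial by monomial. *)
Definition rev_poly m A : {poly F} := \poly_(i < m.+1) A`_(m - i).

Lemma rev_polyD m : {morph rev_poly m : A B / A + B}.
Proof.
move=> A B; apply/polyP => i; rewrite coefD !coef_poly coefD.
by case: ifP => //; rewrite addr0.
Qed.

Lemma rev_poly0 m : rev_poly m 0 = 0.
Proof. by apply/polyP => i; rewrite coef_poly !coef0 if_same. Qed.

Lemma rev_poly_sum m I (r : seq I) (P : pred I) (G : I -> {poly F}) :
  rev_poly m (\sum_(i <- r | P i) G i) = \sum_(i <- r | P i) rev_poly m (G i).
Proof. exact: (big_morph _ (rev_polyD m) (rev_poly0 m)). Qed.

Lemma rev_polyXn m e : (e <= m)%N -> rev_poly m 'X^e = 'X^(m - e).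
Proof.
move=> le_em; apply/polyP => i; rewrite coef_poly !coefXn.
case: ltnP => [|lt_mi]; first by rewrite ltnS => le_im; do 2!case: eqP => //; lia.
by case: eqP => //; lia.
Qed.

Lemma rev_poly_prod s :
  rev_poly (size s) (\prod_(b <- s) ('X - b%:P)) =
  \prod_(b <- s) (1 - b *: 'X).
Proof.
elim: s => [|b s IHs].
  by rewrite !big_nil -(expr0 'X) rev_polyXn.
rewrite !big_cons -{}IHs; set A := \prod_(_ <- _) _.
have sA : size A = (size s).+1 by rewrite size_prod_XsubC.
have -> : (1 - b *: 'X) * rev_poly (size s) A =
    rev_poly (size s) A - b *: ('X * rev_poly (size s) A).
  by rewrite mulrBl mul1r -scalerAl.
apply/polyP => i.
rewrite coefB coefZ coefXM !coef_poly.
rewrite mulrBl coefB coefXM coefCM /=.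
case: i => [|i] /=.
  (* The coefficient of [A] in degree [(size s).+1] is a default zero, so [b] does not enter the
     constant term. *)
  by rewrite !subn0 mulr0 (nth_default 0 (n := (size s).+1)) ?sA // mulr0.
rewrite subSS !ltnS; case: (ltngtP i (size s)) => [lt_is|gt_is|->] /=.
- by rewrite subn_eq0 leqNgt lt_is /= subnS.
- by rewrite mulr0 subr0.
- by rewrite subnn eqxx.
Qed.

End Reversal.

Section PowerSums.
Variable F : fieldType.
Implicit Types (A B : {poly F}) (s : seq F).

(* Newton's identities, as the truncated expansion of - X R' / R. *)
Lemma power_sum_series s N (R := \prod_(b <- s) (1 - b *: 'X)) :
  'X^(N.+1) %| R * (\sum_(i < N) (\sum_(b <- s) b ^+ i.+1) *: 'X^(i.+1))
             + 'X * R^`().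
Proof.
rewrite {}/R; elim: s => [|b s IHs].
  rewrite !big_nil mul1r derivC mulr0 addr0 big1 ?dvdp0 // => i _.
  by rewrite big_nil scale0r.
rewrite big_cons; set R := \prod_(_ <- _) _ in IHs *.
set S := \sum_(i < N) _ in IHs.
(* The new root contributes the truncated geometric series of bX / (1 - bX). *)
have -> : \sum_(i < N) (\sum_(c <- b :: s) c ^+ i.+1) *: 'X^(i.+1) =
          S + b *: 'X * \sum_(i < N) (b *: 'X) ^+ i.
  rewrite mulr_sumr -big_split /=; apply: eq_bigr => i _.
  by rewrite big_cons scalerDl addrC -exprS exprZn.
have geo : (b *: 'X - 1) * (\sum_(i < N) (b *: 'X) ^+ i) =
           (b *: 'X) ^+ N - 1 :> {poly F} by rewrite subrX1.
(* The old expression gets multiplied by 1 - bX; truncating the geometric series leaves only the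
   tail R (bX)^(N+1). *)
have -> : (1 - b *: 'X) * R * (S + b *: 'X * \sum_(i < N) (b *: 'X) ^+ i)
     + 'X * ((1 - b *: 'X) * R)^`()
  = (1 - b *: 'X) * (R * S + 'X * R^`())
    - R * (b *: 'X) ^+ N.+1.
  rewrite derivM derivB derivC derivZ derivX sub0r exprS -!mul_polyC.
  have -> : (b%:P * 'X) ^+ N =
            1 + (b%:P * 'X - 1) * (\sum_(i < N) (b%:P * 'X) ^+ i).
    by rewrite !mul_polyC geo addrC subrK.
  ring.
rewrite dvdp_sub //; first exact: dvdp_mull.
by rewrite exprZn -scalerAr scalerAl dvdp_mull.
Qed.

(** Since [R] has constant term 1, it is invertible modulo X^(N+1), and the congruence determines
    all coefficients of degree at most [N]. *)
Lemma coef_power_sum s N (G : {poly F}) (R := \prod_(b <- s) (1 - b *: 'X)) :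
  'X^(N.+1) %| R * G + 'X * R^`() ->
  forall i, (0 < i <= N)%N -> \sum_(b <- s) b ^+ i = G`_i.
Proof.
move=> dvdG; have := power_sum_series s N; rewrite -/R.
set S := \sum_(i < N) _ => dvdS.
have R0 : coprimep 'X^(N.+1) R.
  rewrite coprimep_expl // coprimep_sym coprimepX rootE horner_prod.
  rewrite big1 ?oner_eq0 // => b _.
  by rewrite hornerD hornerC hornerN hornerZ hornerX mulr0 subr0.
have : 'X^(N.+1) %| R * (S - G).
  have -> : R * (S - G) = (R * S + 'X * R^`()) - (R * G + 'X * R^`()) by ring.
  exact: dvdp_sub.
rewrite Gauss_dvdpr // => /dvdpP[Q /polyP eqSG] [|i] // /= lt_iN.
have := eqSG i.+1; rewrite coefMXn ltnS lt_iN coefB => /eqP.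
rewrite subr_eq0 => /eqP <-.
rewrite coef_sum (bigD1 (Ordinal lt_iN)) //= [X in _ + X]big1 ?addr0 => [|j].
  by rewrite coefZ coefXn eqxx mulr1.
rewrite -val_eqE /= coefZ coefXn eqSS eq_sym => /negPf->.
by rewrite mulr0.
Qed.

(** Reads the result off a guessed sparse series with exponents [g l] and coefficients [c l].
    Monotonicity of [g] prevents terms from merging, and the two lists agree because both are
    strictly increasing with the same members. *)
Lemma nz_indices_mkseq m (beta : m.-tuple F) r (g : nat -> nat) (c : nat -> F)
    (R := rev_poly m (\prod_(b <- beta) ('X - b%:P))) :
  (forall l, (l < r)%N -> (0 < g l <= m)%N) ->
  (forall k l, (k < l < r)%N -> (g k < g l)%N) ->
  (forall l, (l < r)%N -> c l != 0) ->
  'X^(m.+1) %| R * (\sum_(l < r) c l *: 'X^(g l)) + 'X * R^`() ->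
  nz_indices beta = mkseq g r /\
  forall l, (l < r)%N -> power_sum beta (g l) = c l.
Proof.
move=> g_bd g_mono c_neq0.
have RE : R = \prod_(b <- beta) (1 - b *: 'X).
  by rewrite -rev_poly_prod size_tuple.
rewrite RE => /coef_power_sum sE.
have {}sE i : (0 < i <= m)%N ->
    power_sum beta i = \sum_(l < r) c l * (i == g l)%:R.
  move=> /sE; rewrite big_tuple coef_sum /power_sum => ->.
  by apply: eq_bigr => l _; rewrite coefZ coefXn.
have sgE l : (l < r)%N -> power_sum beta (g l) = c l.
  move=> lt_lr; rewrite sE ?g_bd // (bigD1 (Ordinal lt_lr)) //= eqxx mulr1.
  rewrite big1 ?addr0 // => k; rewrite -val_eqE /= => neq_kl.
  case: eqP => [eq_g|_]; last by rewrite mulr0.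
  have [lt_kl|lt_lk|eq_kl] := ltngtP k l; last by rewrite eq_kl eqxx in neq_kl.
    by have := g_mono k l; rewrite lt_kl lt_lr eq_g ltnn => /(_ isT).
  by have := g_mono l k; rewrite lt_lk ltn_ord eq_g ltnn => /(_ isT).
split=> //; apply: (irr_sorted_eq ltn_trans ltnn (nz_indices_sorted beta)).
  apply/(sortedP 0%N) => i; rewrite size_mkseq => lt_ir.
  by rewrite !nth_mkseq ?(ltnW lt_ir) //; apply: g_mono; rewrite leqnn.
move=> i; rewrite mem_nz_indices; apply/idP/mapP => [/and3P[i_gt0 le_im]|[l]].
  rewrite sE ?i_gt0 // => s_neq0; apply/mapP; move: s_neq0.
  apply: contraNT => /mapP not_g; rewrite big1 // => l _.
  case: eqP => [i_eq|_]; last by rewrite mulr0.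
  by case: not_g; exists (val l); rewrite // mem_iota ltn_ord.
by rewrite mem_iota => /= lt_lr ->; rewrite sgE ?c_neq0 // andbT g_bd.
Qed.

End PowerSums.

(** * The trace polynomial and its reversal *)

Section TracePolynomial.
Variable F : fieldType.
Implicit Types A P : {poly F}.

Lemma sum_ord_pred (V : nmodType) k (f : nat -> V) : (0 < k)%N ->
  \sum_(j < k) f j = \sum_(j < k.-1) f j + f k.-1.
Proof. by case: k => // k _; rewrite big_ord_recr. Qed.

Lemma size_sumXn_leq m k (a : nat -> nat) :
  (forall j, (j < k)%N -> (a j < m)%N) ->
  (size (\sum_(j < k) 'X^(a j) : {poly F})%R <= m)%N.
Proof.
move=> a_lt; apply: leq_trans (size_sum _ _ _) _.
by apply/bigmax_leqP => j _; rewrite size_polyXn a_lt.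
Qed.

(** The bound on [size A] makes X^m the leading term, and [beta] lists as many distinct roots as the
    degree. *)
Lemma monic_eq_prod_roots m (beta : m.-tuple F) A :
  (size A <= m)%N -> uniq beta ->
  (forall x, root ('X^m + A) x = (x \in beta)) ->
  'X^m + A = \prod_(b <- beta) ('X - b%:P).
Proof.
move=> sA beta_uniq betaP.
have sXA : size ('X^m + A) = m.+1 by rewrite size_polyDl size_polyXn.
rewrite [LHS](@all_roots_prod_XsubC _ _ beta) ?size_tuple ?uniq_rootsE //.
  by rewrite lead_coefDl ?size_polyXn // lead_coefXn scale1r.
by apply/allP => x; rewrite betaP.
Qed.

Lemma dvdp_Xn_sub1 N a c : 'X^N - 1 %| ('X^(a + c * N) - 'X^a : {poly F}).
Proof.
rewrite exprD mulnC exprM -{2}['X^a]mulr1 -mulrBr.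
by apply: dvdp_mull; rewrite [X in _ %| X]subrX1 dvdp_mulr.
Qed.

Lemma tr_poly_comp_Xn q k b :
  tr_poly F q k \Po 'X^b = \sum_(j < k) 'X^(q ^ j * b).
Proof.
rewrite /tr_poly raddf_sum; apply: eq_bigr => j _ /=.
by rewrite comp_Xn_poly -exprM mulnC.
Qed.

Lemma modp_eq_small P A D :
  D %| P - A -> (size A < size D)%N -> P %% D = A.
Proof.
by move=> /modp_eq0P; rewrite modpD modpN => /subr0_eq-> /modp_small.
Qed.

Lemma mdegE q n t : (0 < t <= n)%N ->
  mdeg q n t = (q ^ (2 * n - t).-1 * (1 + q ^ t))%N.
Proof.
move=> t_bd; rewrite /mdeg mulnDr muln1 -expnD; congr (q ^ _ + q ^ _)%N; lia.
Qed.

Lemma mdeg_expand q n t (x := (q ^ (2 * n - t).-1)%N) : (0 < t <= n)%N ->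
  mdeg q n t = (x + q * x * q ^ t.-1)%N.
Proof.
move=> t_bd; rewrite mdegE // (expn_pred q (k := t)) -/x.
  by rewrite mulnDr muln1 mulnCA mulnA.
by case/andP: t_bd.
Qed.

(** Ensures that an explicit polynomial of degree m is already reduced. The condition [2 < q * n]
    only rules out q = 2, n = 1, where both sides equal 3. *)
Lemma mdeg_lt q n t : (1 < q)%N -> (0 < t <= n)%N -> (2 < q * n)%N ->
  (mdeg q n t < q ^ (2 * n) - 1)%N.
Proof.
move=> q_gt1 t_bd qn; rewrite /mdeg.
have -> : (2 * n = (2 * n - 2).+2)%N by lia.
have le_exp : (q ^ ((2 * n - 2).+2 - 1 - t) <= q ^ (2 * n - 2))%N.
  by rewrite leq_exp2l //; lia.
rewrite !subn1 /= in le_exp *; rewrite !expnS.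
set y := (q ^ _)%N in le_exp *; set x := (q ^ (2 * n - 2))%N in le_exp *.
have x_gt0 : (0 < x)%N by rewrite expn_gt0 ltnW.
have [q2|q_gt2] : q = 2%N \/ (2 < q)%N by lia.
  have : (2 ^ 2 <= x)%N by rewrite /x q2 leq_exp2l //; lia.
  rewrite q2; lia.
have : (q * x >= 3 * x)%N by rewrite leq_mul2r q_gt2 orbT.
have : (q * (q * x) >= 3 * (q * x))%N by rewrite leq_mul2r q_gt2 orbT.
lia.
Qed.

Lemma expn_le_mdeg q n t j : (1 < q)%N -> (0 < t <= n)%N -> (j < 2 * n - t)%N ->
  (q ^ j * (1 + q ^ t) <= mdeg q n t)%N.
Proof.
by move=> q_gt1 t_bd lt_j; rewrite mdegE // leq_expn_mull ?(ltnW q_gt1) //; lia.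
Qed.

Lemma expn_lt_mdeg q n t j : (1 < q)%N -> (0 < t < n)%N -> (j < t)%N ->
  (q ^ j * (1 + q ^ (2 * n - t)) < mdeg q n t)%N.
Proof.
move=> q_gt1 t_bd lt_j; rewrite /mdeg mulnDr muln1 -expnD.
rewrite -addSn leq_add //; first by rewrite ltn_exp2l //; lia.
by rewrite leq_exp2l //; lia.
Qed.

(** Since q^(u+t) = q^(2n) is 1 modulo q^(2n) - 1, the trace term of rank u + j reduces to the
    exponent q^j (1 + q^u). All exponents are then at most m. *)
Lemma Trb_lt q n t (u := (2 * n - t)%N) : (1 < q)%N -> (0 < t < n)%N ->
  Trb F q n t = 1 + \sum_(j < u) 'X^(q ^ j * (1 + q ^ t))
                  + \sum_(j < t) 'X^(q ^ j * (1 + q ^ u)).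
Proof.
move=> q_gt1 t_bd; have q_gt0 := ltnW q_gt1.
have ut : (2 * n = u + t)%N by lia.
have m_lt : (mdeg q n t < q ^ (2 * n) - 1)%N by apply: mdeg_lt => //; nia.
apply: modp_eq_small.
  rewrite /Pb; case/andP: t_bd => _ ->; rewrite tr_poly_comp_Xn.
  rewrite [in X in _ %| X]ut big_split_ord /=.
  have addE (A1 A2 A3 : {poly F}) : 1 + (A1 + A2) - (1 + A1 + A3) = A2 - A3.
    by ring.
  rewrite addE -sumrB; elim/big_ind: _ => [|A1 A2|j _].
  - exact: dvdp0.
  - exact: dvdp_add.
  have -> : (q ^ (u + j) * (1 + q ^ t) =
             q ^ j * (1 + q ^ u) + q ^ j * (q ^ (2 * n) - 1))%N.
    rewrite ut !expnD mulnBr !mulnDr !muln1.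
    have : (q ^ j <= q ^ j * (q ^ u * q ^ t))%N.
      by rewrite leq_pmulr // muln_gt0 !expn_gt0 q_gt0.
    nia.
  exact: dvdp_Xn_sub1.
rewrite size_Xn_sub_1; last exact: leq_trans m_lt.
rewrite ltnS; apply: leq_trans m_lt.
apply: leq_trans (size_polyD _ _) _; rewrite geq_max; apply/andP; split.
  apply: leq_trans (size_polyD _ _) _; rewrite geq_max size_polyC oner_neq0 /=.
  apply: (size_sumXn_leq (a := fun j => (q ^ j * (1 + q ^ t))%N)) => j lt_j.
  rewrite ltnS.
  by apply: expn_le_mdeg => //; case/andP: t_bd => -> /ltnW.
apply: (size_sumXn_leq (a := fun j => (q ^ j * (1 + q ^ u))%N)) => j lt_j.
exact: (ltnW (expn_lt_mdeg _ _ _)).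
Qed.

Lemma Trb_diag q n : (1 < q)%N -> (0 < n)%N -> (2 < q * n)%N ->
  Trb F q n n = 1 + \sum_(j < n) 'X^(q ^ j * (1 + q ^ n)).
Proof.
move=> q_gt1 n_gt0 qn.
have m_lt : (mdeg q n n < q ^ (2 * n) - 1)%N by apply: mdeg_lt; rewrite ?n_gt0 /=.
apply: modp_eq_small; first by rewrite /Pb ltnn tr_poly_comp_Xn subrr dvdp0.
rewrite size_Xn_sub_1; last exact: leq_trans m_lt.
rewrite ltnS; apply: leq_trans m_lt.
apply: leq_trans (size_polyD _ _) _; rewrite geq_max size_polyC oner_neq0 /=.
apply: (size_sumXn_leq (a := fun j => (q ^ j * (1 + q ^ n))%N)) => j lt_j; rewrite ltnS.
by apply: expn_le_mdeg; rewrite ?n_gt0 //=; lia.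
Qed.

(** Tr_b is monic of degree m, its leading monomial being the term j = u-1 of the first sum. It is
    therefore the product of the X - beta_j, and reversal sends X^e to X^(m - e). *)
Lemma rev_Trb_lt q n t (beta : (mdeg q n t).-tuple F)
    (m := mdeg q n t) (u := (2 * n - t)%N) :
  (1 < q)%N -> (0 < t < n)%N ->
  uniq beta -> (forall x : F, root (Trb F q n t) x = (x \in beta)) ->
  rev_poly m (\prod_(b <- beta) ('X - b%:P)) =
  'X^m + \sum_(j < u) 'X^(m - q ^ j * (1 + q ^ t))
       + \sum_(j < t) 'X^(m - q ^ j * (1 + q ^ u)).
Proof.
move=> q_gt1 t_bd beta_uniq; rewrite Trb_lt // -/u.
have t_bd' : (0 < t <= n)%N by case/andP: t_bd => -> /ltnW.
have u_gt0 : (0 < u)%N by lia.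
set A := 1 + \sum_(j < u.-1) 'X^(q ^ j * (1 + q ^ t))
           + \sum_(j < t) 'X^(q ^ j * (1 + q ^ u)) : {poly F}.
have -> : 1 + \sum_(j < u) 'X^(q ^ j * (1 + q ^ t))
            + \sum_(j < t) 'X^(q ^ j * (1 + q ^ u)) = 'X^m + A.
  rewrite (sum_ord_pred (fun j => 'X^(q ^ j * (1 + q ^ t))) u_gt0).
  by rewrite -mdegE // -/m /A; ring.
move=> betaP; rewrite -(monic_eq_prod_roots _ beta_uniq betaP).
  rewrite !rev_polyD !rev_poly_sum rev_polyXn // subnn expr0.
  have -> : rev_poly m 1 = 'X^m :> {poly F}.
    by rewrite -(expr0 'X) rev_polyXn // subn0.
  rewrite (sum_ord_pred (fun j => 'X^(m - q ^ j * (1 + q ^ t))) u_gt0).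
  rewrite -mdegE // -/m subnn expr0.
  rewrite (eq_bigr (fun j : 'I_u.-1 => 'X^(m - q ^ j * (1 + q ^ t)))) => [|j _].
    rewrite (eq_bigr (fun j : 'I_t => 'X^(m - q ^ j * (1 + q ^ u)))) => [|j _].
      ring.
    by rewrite rev_polyXn // ltnW // expn_lt_mdeg.
  by rewrite rev_polyXn // expn_le_mdeg //; have := ltn_ord j; lia.
have m_gt0 : (0 < m)%N by rewrite /m mdegE // muln_gt0 expn_gt0 ltnW.
apply: leq_trans (size_polyD _ _) _; rewrite geq_max; apply/andP; split.
  apply: leq_trans (size_polyD _ _) _.
  rewrite geq_max size_polyC oner_neq0 m_gt0 /=.
  apply: (size_sumXn_leq (a := fun j => (q ^ j * (1 + q ^ t))%N)) => j lt_j.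
  by rewrite /m mdegE // ltn_mul2r ltn_exp2l //; lia.
apply: (size_sumXn_leq (a := fun j => (q ^ j * (1 + q ^ u))%N)) => j lt_j.
exact: expn_lt_mdeg.
Qed.

Lemma rev_Trb_diag q n (beta : (mdeg q n n).-tuple F) (m := mdeg q n n) :
  (1 < q)%N -> (0 < n)%N -> (2 < q * n)%N ->
  uniq beta -> (forall x : F, root (Trb F q n n) x = (x \in beta)) ->
  rev_poly m (\prod_(b <- beta) ('X - b%:P)) =
  'X^m + \sum_(j < n) 'X^(m - q ^ j * (1 + q ^ n)).
Proof.
move=> q_gt1 n_gt0 qn beta_uniq; rewrite Trb_diag //.
have n_bd : (0 < n <= n)%N by rewrite n_gt0 /=.
have mE : m = (q ^ n.-1 * (1 + q ^ n))%N.
  by rewrite /m mdegE //; congr (q ^ _ * _)%N; lia.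
set A := 1 + \sum_(j < n.-1) 'X^(q ^ j * (1 + q ^ n)) : {poly F}.
have -> : 1 + \sum_(j < n) 'X^(q ^ j * (1 + q ^ n)) = 'X^m + A.
  rewrite (sum_ord_pred (fun j => 'X^(q ^ j * (1 + q ^ n))) n_gt0) -mE /A; ring.
move=> betaP; rewrite -(monic_eq_prod_roots _ beta_uniq betaP).
  rewrite !rev_polyD !rev_poly_sum rev_polyXn // subnn expr0.
  have -> : rev_poly m 1 = 'X^m :> {poly F}.
    by rewrite -(expr0 'X) rev_polyXn // subn0.
  rewrite (sum_ord_pred (fun j => 'X^(m - q ^ j * (1 + q ^ n))) n_gt0) -mE subnn expr0.
  rewrite (eq_bigr (fun j : 'I_n.-1 => 'X^(m - q ^ j * (1 + q ^ n)))) => [|j _].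
    ring.
  by rewrite rev_polyXn // expn_le_mdeg //; have := ltn_ord j; lia.
have m_gt0 : (0 < m)%N by rewrite mE muln_gt0 expn_gt0 ltnW.
apply: leq_trans (size_polyD _ _) _; rewrite geq_max size_polyC oner_neq0 m_gt0 /=.
apply: (size_sumXn_leq (a := fun j => (q ^ j * (1 + q ^ n))%N)) => j lt_j.
by rewrite -/m mE ltn_mul2r ltn_exp2l //; lia.
Qed.

End TracePolynomial.

(** * The operator X d/dX in characteristic p, and alternating geometric sums *)

Section LogDerivative.
Variables (F : fieldType) (p : nat).
Hypothesis charFp : p \in [pchar F].

Lemma mulX_derivXn k : 'X * ('X^k)^`() = 'X^k *+ k :> {poly F}.
Proof. by case: k => [|k]; rewrite derivXn ?mulr0n ?mulr0 // mulrnAr -exprS. Qed.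

Lemma mulX_derivXn_dvd k : (p %| k)%N -> 'X * ('X^k)^`() = 0 :> {poly F}.
Proof.
rewrite (dvdn_pcharf charFp) mulX_derivXn => /eqP k0.
by rewrite -scaler_nat k0 scale0r.
Qed.

(** For j > 0 the exponent is a multiple of p; for j = 0 it is m - c, which is -1 modulo p. *)
Lemma mulX_deriv_sum m c q k :
  (p %| m)%N -> (p %| q)%N -> (p %| c.-1)%N -> (0 < c <= m)%N -> (0 < k)%N ->
  'X * (\sum_(j < k) 'X^(m - q ^ j * c))^`() = - 'X^(m - c) :> {poly F}.
Proof.
move=> pm pq pc /andP[c_gt0 le_cm]; case: k => // k _.
rewrite big_ord_recl derivD mulrDr raddf_sum /= mulr_sumr big1 => [|j _]; last first.
  by rewrite mulX_derivXn_dvd // dvdn_sub // expnS -mulnA dvdn_mulr.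
rewrite addr0 expn0 mul1n mulX_derivXn -scaler_nat natrB //.
have -> : m%:R = 0 :> F by apply/eqP; rewrite -(dvdn_pcharf charFp).
have -> : c%:R = 1 :> F.
  rewrite -(prednK c_gt0) -addn1 natrD; have /eqP-> : c.-1%:R == 0 :> F.
    by rewrite -(dvdn_pcharf charFp).
  by rewrite add0r.
by rewrite sub0r scaleN1r.
Qed.

(** For odd p the exponent is odd; for p = 2 both signs coincide. *)
Lemma sign_pchar_exp e : prime p -> (0 < e)%N -> (-1) ^+ (p ^ e) = -1 :> F.
Proof.
move=> p_pr e_gt0; rewrite -signr_odd oddX.
have [p2|->] := even_prime p_pr; last by rewrite orbT expr1.
have ch2 : 2%N \in [pchar F] by rewrite -p2.
by rewrite p2 (gtn_eqF e_gt0) /= expr0 (oppr_pchar2 ch2).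
Qed.

End LogDerivative.

(** The ratio is -X^d, so the product telescopes to X^i0 (1 - (-X^d)^q); the hypothesis on the sign
    of (-1)^q turns the minus into a plus. *)
Lemma geometric_series (F : fieldType) i0 d q : (-1) ^+ q = -1 :> F ->
  (1 + 'X^d) * (\sum_(l < q) (-1) ^+ l *: 'X^(i0 + l * d)) =
  'X^i0 + 'X^(i0 + q * d) :> {poly F}.
Proof.
move=> signq.
have -> : \sum_(l < q) (-1) ^+ l *: 'X^(i0 + l * d) =
          'X^i0 * \sum_(l < q) (- 'X^d) ^+ l :> {poly F}.
  rewrite mulr_sumr; apply: eq_bigr => l _.
  by rewrite exprD [in RHS]exprNn -exprM mulnC scalerAr -mul_polyC rmorphXn /= rmorphN1.
have /eqP := subrX1 (- 'X^d : {poly F}) q.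
rewrite exprNn -exprM mulnC.
have -> : (-1) ^+ q = -1 :> {poly F}.
  by rewrite -[-1](rmorphN1 polyC) -rmorphXn /= signq.
rewrite exprD => /eqP; set S := \sum_(l < q) _; rewrite mulN1r => eqS.
have -> : 'X^(q * d) = - (- 'X^(q * d) - 1) - 1 :> {poly F} by ring.
rewrite eqS; ring.
Qed.

(** * Nonzero power sums *)

Section GeometricPowerSums.
Variables (F : fieldType) (m : nat) (beta : m.-tuple F) (q i0 d : nat).
Variable E : {poly F}.
Let R := rev_poly m (\prod_(b <- beta) ('X - b%:P)).
Hypotheses (signq : (-1) ^+ q = -1 :> F) (q_gt0 : (0 < q)%N).
Hypotheses (i0_gt0 : (0 < i0)%N) (d_gt0 : (0 < d)%N).
Hypothesis dvdE : 'X^(m.+1) %| 'X^i0 * E.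
Hypothesis dR : 'X * R^`() = - ('X^i0 + 'X^(i0 + q * d)).

Let G : {poly F} := \sum_(l < q) (-1) ^+ l *: 'X^(i0 + l * d).

Let dvdG : 'X^i0 %| G.
Proof.
rewrite /G; elim/big_ind: _ => [|A1 A2|l _]; [exact: dvdp0|exact: dvdp_add|].
by rewrite -mul_polyC dvdp_mull // exprD dvdp_mulr.
Qed.

(** Every term of [G] is a multiple of X^i0, so [E] is negligible modulo X^(m+1). *)
Let dvdEG : 'X^(m.+1) %| E * G.
Proof. by case/dvdpP: dvdG => A ->; rewrite mulrCA dvdp_mull // mulrC. Qed.

Lemma nz_indices_geometric : R = 1 + 'X^d + E -> (i0 + q.-1 * d <= m)%N ->
  nz_indices beta = mkseq (fun l => i0 + l * d)%N q /\
  forall l, (l < q)%N -> power_sum beta (i0 + l * d) = (-1) ^+ l.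
Proof.
move=> RE le_m; apply: nz_indices_mkseq => [l lt_lq|k l lt_klq|l _|].
- rewrite addn_gt0 i0_gt0 /=; apply: leq_trans le_m.
  by rewrite leq_add2l leq_mul2r; apply/orP; right; lia.
- by rewrite ltn_add2l ltn_mul2r d_gt0; case/andP: lt_klq.
- by rewrite signr_eq0.
rewrite -/R -/G dR RE mulrDl (geometric_series _ _ signq).
by rewrite addrAC subrr add0r.
Qed.

(** The monomial X^k adds X^k [G] to the product, of which only X^(i0 + k) has degree at most m.
    Subtracting X^(i0 + k) from [G] cancels it, and its coefficient -1 = (-1)^q continues the
    alternating pattern. *)
Lemma nz_indices_geometric_rcons k
    (g := fun l => if (l < q)%N then (i0 + l * d)%N else (i0 + k)%N) :
  R = 1 + 'X^d + ('X^k + E) ->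
  (q.-1 * d < k)%N -> (d <= k)%N -> (i0 + k <= m < i0 + k + d)%N ->
  nz_indices beta = mkseq g q.+1 /\
  forall l, (l < q.+1)%N -> power_sum beta (g l) = (-1) ^+ l.
Proof.
move=> RE lt_k le_dk /andP[le_m gt_m].
have gE l : (l < q)%N -> g l = (i0 + l * d)%N by rewrite /g => ->.
have gq : g q = (i0 + k)%N by rewrite /g ltnn.
have g_lt l : (l < q)%N -> (g l < i0 + k)%N.
  move=> lt_lq; rewrite gE // ltn_add2l; apply: leq_ltn_trans lt_k.
  by rewrite leq_mul2r; apply/orP; right; lia.
apply: nz_indices_mkseq => [l lt_lq|k' l /andP[lt_kl lt_lq]|l _|].
- move: lt_lq; rewrite ltnS leq_eqVlt => /orP[/eqP->|lt_lq].
    by rewrite gq addn_gt0 i0_gt0.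
  by rewrite (leq_trans (ltnW (g_lt l lt_lq))) // gE // addn_gt0 i0_gt0.
- move: lt_lq; rewrite ltnS leq_eqVlt => /orP[/eqP eq_l|lt_lq].
    by rewrite eq_l gq g_lt // -eq_l.
  by rewrite !gE ?(ltn_trans lt_kl) // ltn_add2l ltn_mul2r d_gt0.
- by rewrite signr_eq0.
rewrite -/R big_ord_recr /= gq signq scaleN1r.
rewrite (eq_bigr (fun l : 'I_q => (-1) ^+ l *: 'X^(i0 + l * d))) => [|l _].
  2: by rewrite gE.
rewrite -/G dR.
(* Three negligible groups remain: the tail of X^k [G], the terms containing [E], and the correction
   times X^d and X^k. The last one uses d <= k. *)
have -> : R * (G - 'X^(i0 + k)) - ('X^i0 + 'X^(i0 + q * d)) =
    'X^k * (G - 'X^i0) + (E * G - 'X^k * ('X^i0 * E))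
    - ('X^(i0 + k + d) + 'X^(i0 + k + k)).
  have -> : R * (G - 'X^(i0 + k)) =
     (1 + 'X^d) * G + ('X^k + E) * G - R * 'X^(i0 + k).
    by rewrite RE; ring.
  by rewrite (geometric_series _ _ signq) RE !exprD; ring.
have GE : 'X^(i0 + d) %| G - 'X^i0.
  rewrite /G -(prednK q_gt0) big_ord_recl mul0n addn0 expr0 scale1r.
  rewrite addrAC subrr add0r.
  elim/big_ind: _ => [|A1 A2|l _]; [exact: dvdp0|exact: dvdp_add|].
  by rewrite -mul_polyC dvdp_mull // dvdp_exp2l // leq_add2l leq_pmull.
apply: dvdp_sub; first apply: dvdp_add.
- case/dvdpP: GE => A ->; rewrite mulrCA dvdp_mull // -exprD dvdp_exp2l //.
  by rewrite addnA (addnC k).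
- by rewrite dvdp_sub // dvdp_mull.
by rewrite dvdp_add // dvdp_exp2l // (leq_trans gt_m) // leq_add2l.
Qed.

End GeometricPowerSums.

Lemma dvdp_Xn_sum (F : fieldType) N i k (f : nat -> nat) :
  (forall j, (j < k)%N -> (N <= i + f j)%N) ->
  'X^N %| 'X^i * (\sum_(j < k) 'X^(f j) : {poly F}).
Proof.
move=> le_N; rewrite mulr_sumr; elim/big_ind: _ => [|A1 A2|j _].
- exact: dvdp0.
- exact: dvdp_add.
by rewrite -exprD dvdp_exp2l // le_N.
Qed.

Lemma card_pchar (F : finFieldType) p e q k :
  prime p -> q = (p ^ e)%N -> #|F| = (q ^ k)%N -> p \in [pchar F].
Proof.
by move=> p_pr -> cardF; apply: (@card_finPcharP F p (e * k)); rewrite // expnM.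
Qed.

Lemma prime_power_gt1 p e q :
  prime p -> (0 < e)%N -> q = (p ^ e)%N -> (1 < q)%N.
Proof. by move=> p_pr e_gt0 ->; rewrite -(exp1n e) ltn_exp2r ?prime_gt1. Qed.

Lemma dvdn_prime_power p e q k :
  (0 < e)%N -> q = (p ^ e)%N -> (0 < k)%N -> (p %| q ^ k)%N.
Proof.
move=> e_gt0 -> k_gt0; rewrite -expnM (expn_pred p (k := e * k)) ?dvdn_mulr //.
by rewrite muln_gt0 e_gt0.
Qed.

(** * The case t < n *)

Section OffDiagonal.
Variables (p e q n t : nat) (F : finFieldType).
Hypotheses (p_pr : prime p) (e_gt0 : (0 < e)%N) (qE : q = (p ^ e)%N).
Hypothesis t_bd : (0 < t < n)%N.
Hypothesis cardF : #|F| = (q ^ (2 * n))%N.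
Variable beta : (mdeg q n t).-tuple F.
Hypothesis beta_uniq : uniq beta.
Hypothesis betaP : forall x : F, root (Trb F q n t) x = (x \in beta).

Let m := mdeg q n t.
Let u := (2 * n - t)%N.
Let x := (q ^ u.-1)%N.
Let y := (q ^ t.-1)%N.
Let R := rev_poly m (\prod_(b <- beta) ('X - b%:P)).

Let q_gt1 : (1 < q)%N. Proof. exact: prime_power_gt1 qE. Qed.
Let charFp : p \in [pchar F]. Proof. exact: card_pchar qE cardF. Qed.
Let signq : (-1) ^+ q = -1 :> F. Proof. by rewrite qE (sign_pchar_exp charFp). Qed.
Let t_gt0 : (0 < t)%N. Proof. by case/andP: t_bd. Qed.
Let u_gt0 : (0 < u)%N. Proof. by rewrite /u; lia. Qed.
Let y_gt0 : (0 < y)%N. Proof. by rewrite expn_gt0 ltnW. Qed.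
Let y_lt_x : (y < x)%N. Proof. by rewrite ltn_exp2l //; rewrite /u; lia. Qed.
Let qx : (q ^ u = q * x)%N. Proof. by rewrite (expn_pred q u_gt0). Qed.
Let qy : (q ^ t = q * y)%N. Proof. by rewrite (expn_pred q t_gt0). Qed.

Let mE : m = (x + q * x * y)%N.
Proof. by rewrite /m mdeg_expand //; case/andP: t_bd => -> /ltnW. Qed.

Let lt_k1 : (1 + q * x < m)%N.
Proof. by rewrite mE gap_all ?(ltnW q_gt1) // y_gt0. Qed.

(** The leading term j = u-1 of the first sum reverses to 1, and the term of exponent k_t to X^d,
    where d = [x - y]. *)
Let revE : R = 1 + 'X^(x - y)
  + ('X^m + \sum_(j < u.-1) 'X^(m - q ^ j * (1 + q ^ t))
          + \sum_(j < t.-1) 'X^(m - q ^ j * (1 + q ^ u))).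
Proof.
rewrite /R rev_Trb_lt // -/m -/u.
rewrite (sum_ord_pred (fun j => 'X^(m - q ^ j * (1 + q ^ t))) u_gt0).
rewrite (sum_ord_pred (fun j => 'X^(m - q ^ j * (1 + q ^ u))) t_gt0).
have -> : (m - q ^ u.-1 * (1 + q ^ t) = 0)%N.
  by rewrite -/x qy mE mulnDr muln1 mulnCA mulnA subnn.
have -> : (m - q ^ t.-1 * (1 + q ^ u) = x - y)%N.
  by rewrite -/y qx mE mulnDr muln1 (mulnC y) subnDr.
ring.
Qed.

(** Each sum contributes only its term j = 0, with exponents m - (1 + q^t) and i0. The former equals
    i0 + q d because q d = q^u - q^t. *)
Let rev_derivE :
  'X * R^`() = - ('X^(m - (1 + q * x)) + 'X^(m - (1 + q * x) + q * (x - y))).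
Proof.
have dvd_pX := dvdn_prime_power e_gt0 qE.
have u1_gt0 : (0 < u.-1)%N by rewrite /u; lia.
have pm : (p %| m)%N by rewrite mE -mulnA mulnCA dvdn_add ?dvdn_mulr ?dvd_pX.
have pq : (p %| q)%N by rewrite -(expn1 q) dvd_pX.
have le_yx : (q * y <= q * x)%N by rewrite leq_mul2l (ltnW y_lt_x) orbT.
rewrite /R rev_Trb_lt // -/m -/u derivD mulrDr derivD mulrDr.
rewrite (mulX_derivXn_dvd charFp pm) add0r.
rewrite !(mulX_deriv_sum charFp) //= ?dvd_pX //.
- by rewrite qx qy -opprD addrC mulnBr (subnS_addn le_yx lt_k1).
- by rewrite qx ltnW.
- by rewrite qy (leq_trans _ (ltnW lt_k1)) // leq_add2l.
Qed.

Lemma nz_indices_off (i0 := (m - (1 + q * x))%N) : (1 < t)%N ->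
  nz_indices beta = mkseq (fun l => i0 + l * (x - y))%N q /\
  forall l, (l < q)%N -> power_sum beta (i0 + l * (x - y)) = (-1) ^+ l.
Proof.
move=> t_gt1; have t_bd' : (1 < t < n)%N by rewrite t_gt1; case/andP: t_bd.
have := off_gaps q_gt1 t_bd'; rewrite -/u -/x -/y -mE => -[gap_m gap_u gap_t le_m].
apply: (nz_indices_geometric signq _ _ _ _ rev_derivE revE) => //.
- exact: ltnW.
- by rewrite subn_gt0.
- by rewrite subn_gt0.
rewrite !mulrDr -exprD; apply: dvdp_add; last exact: dvdp_Xn_sum gap_t.
by apply: dvdp_add; [rewrite dvdp_exp2l|apply: dvdp_Xn_sum gap_u].
Qed.

(** For t = 1 the second sum is X^d alone, and the term j = u-2 of the first sum is the surviving
    X^k. *)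
Lemma nz_indices_one (i0 := (m - (1 + q * x))%N)
    (k := (m - q ^ u.-2 * (1 + q))%N)
    (g := fun l => if (l < q)%N then (i0 + l * (x - y))%N else (i0 + k)%N) :
  t = 1%N -> (q, n) <> (2, 2)%N ->
  nz_indices beta = mkseq g q.+1 /\
  forall l, (l < q.+1)%N -> power_sum beta (g l) = (-1) ^+ l.
Proof.
move=> t1 qn; have n_gt1 : (1 < n)%N by case/andP: t_bd; rewrite t1.
have y1 : y = 1%N by rewrite /y t1.
have uE : (2 * n - 1)%N = u by rewrite /u t1.
have mE1 : (x + q * x)%N = m by rewrite mE y1 muln1.
have := one_gaps q_gt1 n_gt1 qn; rewrite uE -/x mE1 -/i0 -/k.
have -> : (x - 1 = x - y)%N by rewrite y1.
case=> gap_m gap_u lt_k le_k bd_k.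
have u1_gt0 : (0 < u.-1)%N by rewrite /u; lia.
pose E : {poly F} := 'X^m + \sum_(j < u.-2) 'X^(m - q ^ j * (1 + q)).
have RE : R = 1 + 'X^(x - y) + ('X^k + E).
  rewrite revE [in t.-1]t1 big_ord0 addr0 t1 expn1.
  by rewrite (sum_ord_pred (fun j => 'X^(m - q ^ j * (1 + q))) u1_gt0) /E /k; ring.
apply: (nz_indices_geometric_rcons signq _ _ _ _ rev_derivE RE) => //.
- exact: ltnW.
- by rewrite subn_gt0.
- by rewrite subn_gt0.
rewrite mulrDr -exprD.
by apply: dvdp_add; [rewrite dvdp_exp2l|apply: dvdp_Xn_sum gap_u].
Qed.

End OffDiagonal.

(** In characteristic 2 the polynomial P_b = 1 + X^3 is the modulus X^3 - 1 itself. *)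
Lemma Trb_2_1_1 (F : fieldType) : 2%N \in [pchar F] -> Trb F 2 1 1 = 0.
Proof.
move=> ch2; apply: modp_eq_small; last by rewrite size_poly0 size_Xn_sub_1.
have N1 : 1 = - 1 :> {poly F} by rewrite -[1](polyC1) -polyCN (oppr_pchar2 ch2).
rewrite subr0 /Pb ltnn tr_poly_comp_Xn big_ord1 expn0 mul1n.
by rewrite [X in _ %| X]addrC [X in _ %| _ + X]N1 dvdpp.
Qed.

(** * The case t = n *)

Section Diagonal.
Variables (p e q n : nat) (F : finFieldType).
Hypotheses (p_pr : prime p) (e_gt0 : (0 < e)%N) (qE : q = (p ^ e)%N).
Hypothesis n_gt0 : (0 < n)%N.
Hypothesis cardF : #|F| = (q ^ (2 * n))%N.
Variable beta : (mdeg q n n).-tuple F.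
Hypothesis beta_uniq : uniq beta.
Hypothesis betaP : forall x : F, root (Trb F q n n) x = (x \in beta).

Let q_gt1 : (1 < q)%N. Proof. exact: prime_power_gt1 qE. Qed.
Let charFp : p \in [pchar F]. Proof. exact: card_pchar qE cardF. Qed.

Lemma nz_indices_diag : (1 < n)%N -> (q, n) <> (2, 2)%N ->
  nz_indices beta = mkseq (fun=> mdeg q n n - (1 + q ^ n))%N 1.
Proof.
move=> n_gt1 qn; have [] := diag_gaps q_gt1 n_gt1 qn.
have mE : mdeg q n n = (q ^ n.-1 * (1 + q ^ n))%N.
  rewrite mdegE ?n_gt0 /= //; congr (q ^ _ * _)%N; lia.
rewrite -mE; set m := mdeg q n n in mE *; set i0 := (m - _)%N => i0_bd gap_m gap_n.
have dvd_pX := dvdn_prime_power e_gt0 qE.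
have pq : (p %| q)%N by rewrite -(expn1 q) dvd_pX.
have pm : (p %| m)%N by rewrite mE dvdn_mulr // dvd_pX // -subn1 subn_gt0.
have RE : rev_poly m (\prod_(b <- beta) ('X - b%:P)) =
    1 + ('X^m + \sum_(j < n.-1) 'X^(m - q ^ j * (1 + q ^ n))).
  rewrite rev_Trb_diag // -/m; last by rewrite (leq_trans _ (leq_mul q_gt1 n_gt1)).
  rewrite (sum_ord_pred (fun j => 'X^(m - q ^ j * (1 + q ^ n))) n_gt0).
  by rewrite -mE subnn; ring.
have dR : 'X * (rev_poly m (\prod_(b <- beta) ('X - b%:P)))^`() = - 'X^i0.
  rewrite rev_Trb_diag // -/m; last by rewrite (leq_trans _ (leq_mul q_gt1 n_gt1)).
  rewrite derivD mulrDr (mulX_derivXn_dvd charFp pm) add0r.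
  rewrite (mulX_deriv_sum charFp) //= ?dvd_pX //.
  by rewrite ltnW // -subn_gt0; case/andP: i0_bd.
apply: (proj1 (nz_indices_mkseq (c := fun=> 1) _ _ _ _)) => [l _|k l|l _|] //.
- lia.
- exact: oner_neq0.
rewrite big_ord1 scale1r dR RE mulrDl mul1r addrAC subrr add0r mulrC.
rewrite mulrDr -exprD.
by apply: dvdp_add; [rewrite dvdp_exp2l|apply: dvdp_Xn_sum gap_n].
Qed.

(** For q > 2, R = 1 + X^m with m = q + 1, which is 1 in the field. Hence -X R' = -X^m, and the only
    index is m itself, with power sum -1. *)
Lemma size_nz_indices_diag1 : n = 1%N -> size (nz_indices beta) = 1%N.
Proof.
move=> n1; have [q2|q_gt2] : q = 2%N \/ (2 < q)%N by lia.
  (* The case q = 2 is contradictory: Tr_b vanishes, so all 4 field elements would be among the 3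
     entries of [beta]. *)
  have ch2 : 2%N \in [pchar F].
    by apply: (@card_pchar F 2 1 2 (2 * n)); rewrite // cardF q2.
  have : (#|F| <= size beta)%N.
    rewrite cardE; apply: uniq_leq_size (enum_uniq F) _ => x _.
    by rewrite -betaP q2 n1 Trb_2_1_1 // root0.
  by rewrite size_tuple cardF => le_card; exfalso; move: le_card; rewrite q2 n1.
set m := mdeg q n n.
have mE : m = q.+1 by rewrite /m /mdeg n1 expn1 addnC addn1.
have RE : rev_poly m (\prod_(b <- beta) ('X - b%:P)) = 'X^m + 1.
  rewrite rev_Trb_diag // -/m; last by rewrite n1 muln1.
  by rewrite n1 big_ord1 mul1n expn1 add1n -mE subnn.
have m1 : m%:R = 1 :> F.
  rewrite mE mulrSr; have /eqP-> : q%:R == 0 :> F.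
    by rewrite -(dvdn_pcharf charFp) -(expn1 q) (dvdn_prime_power e_gt0 qE).
  by rewrite add0r.
rewrite (proj1 (@nz_indices_mkseq _ _ beta 1 (fun=> m) (fun=> -1) _ _ _ _)) //.
- by move=> l _; rewrite leqnn mE.
- by move=> k l; lia.
- by move=> l _; rewrite oppr_eq0 oner_neq0.
rewrite -/m RE big_ord1 derivD -[1]/(1%:P) derivC addr0 mulX_derivXn.
rewrite -scaler_nat m1 scale1r.
rewrite scaleN1r mulrDl mul1r mulrN addrNK -exprD dvdpNr dvdp_exp2l //.
by rewrite mE; lia.
Qed.

End Diagonal.

(** * The exceptional pair q = n = 2 *)

Section Exceptional.
Variable F : finFieldType.
Hypothesis cardF : #|F| = 16%N.

Let ch2 : 2%N \in [pchar F].
Proof. exact: (@card_finPcharP F 2 4). Qed.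

Let two0 : 2%:R = 0 :> {poly F}.
Proof. by rewrite -polyC_natr (pcharf0 ch2). Qed.

(** Here m = 12, i0 = d = 3 and k = 6, so i0 + k + d = m and the gap bounds fail by equality. The
    series used instead is R - 1. *)
Lemma nz_indices_2_2_1 (beta : (mdeg 2 2 1).-tuple F) :
  uniq beta -> (forall x : F, root (Trb F 2 2 1) x = (x \in beta)) ->
  nz_indices beta = [:: 3; 6; 9; 12]%N /\
  forall l, (l < 4)%N -> power_sum beta (3 * l.+1) = 1.
Proof.
move=> beta_uniq betaP.
have RE : rev_poly (mdeg 2 2 1) (\prod_(b <- beta) ('X - b%:P)) =
    1 + 'X^3 + 'X^6 + 'X^9 + 'X^12.
  rewrite rev_Trb_lt // !big_ord_recl !big_ord0 /=.
  transitivity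
    ('X^12 + ('X^9 + ('X^6 + ('X^0 + 0))) + ('X^3 + 0) : {poly F}) => //.
  by rewrite expr0; ring.
pose g l := (3 * l.+1)%N.
apply: (@nz_indices_mkseq _ _ beta 4 g (fun=> 1)) => [l|k l|l _|].
- by move: l; do 4?case=> //.
- by rewrite /g; lia.
- exact: oner_neq0.
rewrite RE !big_ord_recl big_ord0 /= !scale1r !derivD -[1]/(1%:P) derivC.
rewrite !mulrDr mulr0 !mulX_derivXn.
set Q := (X in _ %| X).
(* The error is an even part, zero in characteristic 2, plus a multiple of X^15, which lies beyond
   the truncation at X^13. *)
have -> : Q = 2%:R * (2%:R * 'X^3 + 4%:R * 'X^6 + 6%:R * 'X^9 + 8%:R * 'X^12)
     + 'X^15 * (4%:R + 3%:R * 'X^3 + 2%:R * 'X^6 + 'X^9).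
  by rewrite /Q; ring.
by rewrite two0 mul0r add0r dvdp_mulr // dvdp_exp2l.
Qed.

Lemma nz_indices_2_2_2 (beta : (mdeg 2 2 2).-tuple F) :
  uniq beta -> (forall x : F, root (Trb F 2 2 2) x = (x \in beta)) ->
  nz_indices beta = [:: 5; 10]%N.
Proof.
move=> beta_uniq betaP.
have RE : rev_poly (mdeg 2 2 2) (\prod_(b <- beta) ('X - b%:P)) =
    1 + 'X^5 + 'X^10.
  rewrite rev_Trb_diag // !big_ord_recl !big_ord0 /=.
  transitivity ('X^10 + ('X^5 + ('X^0 + 0)) : {poly F}) => //.
  by rewrite expr0; ring.
pose g l := (5 * l.+1)%N.
apply: (proj1 (@nz_indices_mkseq _ _ beta 2 g (fun=> 1) _ _ _ _)) => [l|k l|l _|].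
- by move: l; do 2?case=> //.
- by rewrite /g; lia.
- exact: oner_neq0.
rewrite RE !big_ord_recl big_ord0 /= !scale1r !derivD -[1]/(1%:P) derivC.
rewrite !mulrDr mulr0 !mulX_derivXn.
set Q := (X in _ %| X).
(* The same splitting, now with truncation at X^11. *)
have -> : Q = 2%:R * (3%:R * 'X^5 + 6%:R * 'X^10)
     + 'X^15 * (2%:R + 'X^5).
  by rewrite /Q; ring.
by rewrite two0 mul0r add0r dvdp_mulr // dvdp_exp2l.
Qed.

End Exceptional.

Lemma PoszX (q k : nat) : q%:Z ^+ k = (q ^ k)%N%:Z.
Proof. by rewrite -[q%:Z]natz -natrX natz. Qed.

(** * Closed forms of the indices, computed over the integers *)

Section Indices.
Variables (q n t : nat).
Hypotheses (q_gt1 : (1 < q)%N) (t_bd : (0 < t < n)%N).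
Let u := (2 * n - t)%N.
Let x := (q ^ u.-1)%N.
Let y := (q ^ t.-1)%N.
Let m := mdeg q n t.

Let u_gt0 : (0 < u)%N. Proof. by rewrite /u; lia. Qed.
Let y_lt_x : (y < x)%N. Proof. by rewrite ltn_exp2l //; rewrite /u; lia. Qed.
Let y_gt0 : (0 < y)%N. Proof. by rewrite expn_gt0 ltnW. Qed.
Let qx : (q ^ u = q * x)%N. Proof. by rewrite (expn_pred q u_gt0). Qed.

Let mE : m = (x + q * x * y)%N.
Proof. by rewrite /m mdeg_expand //; case/andP: t_bd => -> /ltnW. Qed.

(** The amount subtracted from m is k_1 - l d. It interpolates all the closed forms: k_1 at l = 0,
    k_1 + k_t - m at l = 1, and j_(2,l-2) from l = 2 on. *)
Lemma index_geometricE l :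
  (m - (1 + q * x) + l * (x - y))%N%:Z =
  m%:Z - (1 + l%:Z * y%:Z + (q%:Z - l%:Z) * x%:Z).
Proof.
have lt_k1 : (1 + q * x <= m)%N.
  by rewrite mE ltnW // gap_all ?(ltnW q_gt1) // y_gt0.
rewrite PoszD PoszM -!subzn ?(ltnW y_lt_x) // PoszD PoszM; ring.
Qed.

Lemma index_k1E : m%:Z - (kidx q n t 1)%:Z = (m - (1 + q * x) + 0 * (x - y))%N%:Z.
Proof. by rewrite index_geometricE /kidx subnn mul1n -/u qx PoszD PoszM; ring. Qed.

Lemma index_ktE : m%:Z - ((kidx q n t 1)%:Z + (kidx q n t t)%:Z - m%:Z) =
  (m - (1 + q * x) + 1 * (x - y))%N%:Z.
Proof.
rewrite index_geometricE /kidx subnn mul1n -/u qx subn1 -/y.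
by rewrite mE !(PoszD, PoszM); ring.
Qed.

Lemma index_j2E l : m%:Z - j2 q n t l = (m - (1 + q * x) + (2 + l) * (x - y))%N%:Z.
Proof. by rewrite index_geometricE /j2 !PoszX !subn1. Qed.

(** With y = 1, the exponent k is q x - q^(u-2), so k - (q-1)(x-1) = x - q^(u-2) + q - 1, where x =
    q^(2n-2). *)
Lemma index_lastE : t = 1%N ->
  (m - (1 + q * x) + (m - q ^ u.-2 * (1 + q)))%N%:Z =
  (m - (1 + q * x) + (q - 1) * (x - y))%N%:Z
    + q%:Z ^+ (2 * n - 2) - q%:Z ^+ (2 * n - 3) + q%:Z - 1.
Proof.
move=> t1; have y1 : y = 1%N by rewrite /y t1.
have u1_gt0 : (0 < u.-1)%N by rewrite /u; lia.
have -> : (2 * n - 2 = u.-1)%N by rewrite /u t1; lia.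
have -> : (2 * n - 3 = u.-2)%N by rewrite /u t1; lia.
have xE : x = (q * q ^ u.-2)%N by rewrite /x (expn_pred q u1_gt0).
rewrite !PoszX -/x PoszD index_geometricE.
have q_gt0 := ltnW q_gt1.
have lt_k1 : (1 + q * x <= m)%N.
  by rewrite mE ltnW // gap_all // y_gt0.
have le_k : (q ^ u.-2 * (1 + q) <= m)%N.
  rewrite mE y1 muln1 mulnDr muln1 mulnC -xE addnC leq_add2l xE mulnA.
  by rewrite leq_pmull // muln_gt0 q_gt0.
rewrite -!subzn // mE y1 !(PoszD, PoszM) xE !PoszM; ring.
Qed.

End Indices.

(** * Assembly of the cases *)

Unset Implicit Arguments.
Set Strict Implicit.
Set Printing Implicit Defensive.

Theorem theorem9 (p e q n t : nat) (F : finFieldType)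
    (hp : prime p) (he : (0 < e)%N) (hq : q = (p ^ e)%N) (hn : (0 < n)%N)
    (ht : (0 < t <= n)%N) (hF : #|F| = (q ^ (2 * n))%N)
    (beta : (mdeg q n t).-tuple F)
    (hbeta_uniq : uniq beta)
    (hbeta_roots : forall x : F, root (Trb F q n t) x = (x \in beta)) :
  let m := mdeg q n t in
  let s := power_sum beta in
  let I := nz_indices beta in
  let i0 := nth 0%N I 0 in
  let i1 := nth 0%N I 1 in
  let i2 := fun l : nat => nth 0%N I (2 + l) in
  let k1 := kidx q n t 1 in
  let kt := kidx q n t t in
  (* part 1 *)
  ((1 < t < n)%N ->
     [/\ size I = q,
         [/\ i0%:Z = m%:Z - k1%:Z,
             i1%:Z = m%:Z - (k1%:Z + kt%:Z - m%:Z)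
           & forall l : nat, (l + 3 <= q)%N -> (i2 l)%:Z = m%:Z - j2 q n t l],
         s i0 = 1 /\
         (forall l : nat, (l + 3 <= q)%N -> ~~ odd l -> s (i2 l) = 1)
       & s i1 = -1 /\
         (forall l : nat, (l + 3 <= q)%N -> odd l -> s (i2 l) = -1)])
  /\
  (* part 2; i_{2,q-3} is the entry of rank q - 1, which is i1 when q = 2 *)
  (t = 1%N -> (1 < n)%N -> (q, n) <> (2, 2)%N ->
     [/\ size I = q.+1,
         [/\ i0%:Z = m%:Z - k1%:Z,
             i1%:Z = m%:Z - (k1%:Z + kt%:Z - m%:Z),
             forall l : nat, (l + 3 <= q)%N -> (i2 l)%:Z = m%:Z - j2 q n t l
           & (i2 (q - 2)%N)%:Z =
               (nth 0%N I (q - 1))%:Z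
               + q%:Z ^+ (2 * n - 2) - q%:Z ^+ (2 * n - 3) + q%:Z - 1],
         s i0 = 1,
         s i1 = -1
       & forall l : nat, (l + 2 <= q)%N ->
           s (i2 l) = if odd l then -1 else 1])
  /\
  (* part 2' *)
  (q = 2%N -> n = 2%N -> t = 1%N ->
     [/\ size I = 4%N,
         [/\ i0%:Z = m%:Z - k1%:Z,
             i1%:Z = m%:Z - (k1%:Z + kt%:Z - m%:Z),
             (i2 0%N)%:Z = m%:Z - j2 q n t 0
           & (i2 1%N)%:Z = m%:Z - j2 q n t 1],
         s i0 = 1 /\ s (i2 0%N) = 1
       & s i1 = -1 /\ s (i2 1%N) = -1])
  /\
  (* part 3; for n = 1 the closed form would be 0, which is not an index *)
  (t = n -> (q, n) <> (2, 2)%N ->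
     size I = 1%N /\
     ((1 < n)%N ->
        i0%:Z = q%:Z ^+ (2 * n - 1) - q%:Z ^+ n + q%:Z ^+ (n - 1) - 1))
  /\
  (q = 2%N -> t = 2%N -> n = 2%N -> [/\ size I = 2%N, i0 = 5%N & i1 = 10%N]).
Proof.
move=> m s I i0 i1 i2 k1 kt.
have q_gt1 : (1 < q)%N := prime_power_gt1 hp he hq.
split.
  case/andP=> t_gt1 lt_tn; have t_bd : (0 < t < n)%N by rewrite ltnW.
  have [IE sE] := nz_indices_off hp he hq t_bd hF hbeta_uniq hbeta_roots t_gt1.
  rewrite /i0 /i1 /i2 /I IE size_mkseq !nth_mkseq ?(ltnW q_gt1) //.
  have i2E l : (l + 3 <= q)%N -> (2 + l < q)%N by lia.
  split=> //.
  - split; [by rewrite index_k1E|by rewrite index_ktE|].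
    by move=> l /i2E lt_l; rewrite nth_mkseq // index_j2E.
  - split=> [|l /i2E lt_l even_l]; first by rewrite /s sE ?(ltnW q_gt1).
    by rewrite nth_mkseq // /s sE // -signr_odd /= negbK (negPf even_l).
  - split=> [|l /i2E lt_l odd_l]; first by rewrite /s sE.
    by rewrite nth_mkseq // /s sE // -signr_odd /= negbK odd_l.
split.
  move=> t1 n_gt1 qn; have t_bd : (0 < t < n)%N by rewrite t1.
  have [IE sE] := nz_indices_one hp he hq t_bd hF hbeta_uniq hbeta_roots t1 qn.
  move: IE sE; set g := (fun l : nat => if _ then _ else _) => IE sE.
  have gE l (x := (q ^ (2 * n - t).-1)%N) : (l < q)%N ->
      g l = (m - (1 + q * x) + l * (x - q ^ t.-1))%N by rewrite /g => ->.
  rewrite /i0 /i1 /i2 /I IE size_mkseq !nth_mkseq //;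
    try by [lia | rewrite ltnW // ltnW].
  have i2E l : (l + 2 <= q)%N -> (2 + l < q.+1)%N by lia.
  split=> //.
  - split.
    + by rewrite gE ?index_k1E // ltnW.
    + by rewrite gE ?index_ktE.
    + move=> l le_l; have lt_l : (2 + l < q)%N by lia.
      by rewrite nth_mkseq ?leqW // gE // index_j2E.
    (* Rank q - 1 is still in the geometric range, whereas 2 + (q - 2) = q is the rank of the extra
       index i0 + k. *)
    + have lt_q : (q - 1 < q)%N by rewrite subn1 prednK // ltnW.
      rewrite subnKC // (gE _ lt_q) /g ltnn.
      by rewrite index_lastE.
  - by rewrite /s sE.
  - by rewrite /s sE // ltnW.
  - move=> l /i2E lt_l; rewrite nth_mkseq // /s sE // -signr_odd /= negbK.
    by case: (odd l).
split.
  (* The type of [beta] depends on q, n and t, so everything built on it is generalized before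
     substituting numerals. *)
  move=> q2 n2 t1; move: beta hF hbeta_uniq hbeta_roots @m @s @I @i0 @i1 @i2 @k1 @kt.
  rewrite q2 n2 t1 => b cF b_uniq bP; cbv zeta.
  have [-> sE] := nz_indices_2_2_1 cF b_uniq bP.
  (* In characteristic 2 both prescribed signs are the common value 1 of the four power sums. *)
  have N1 : -1 = 1 :> F.
    by apply: oppr_pchar2; apply: (@card_finPcharP F 2 4).
  rewrite N1; split=> //=.
  - by split; rewrite (sE 0%N, sE 2%N).
  - by split; rewrite (sE 1%N, sE 3%N).
split.
  move=> tn; move: beta hF hbeta_uniq hbeta_roots @m @s @I @i0 @i1 @i2 @k1 @kt.
  rewrite tn => b cF b_uniq bP; cbv zeta => qn.
  have [n1|n_gt1] : n = 1%N \/ (1 < n)%N by lia.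
    split; last by rewrite {1}n1.
    exact: (size_nz_indices_diag1 hp he hq hn cF b_uniq bP).
  rewrite (nz_indices_diag hp he hq hn cF b_uniq bP) //; split=> // _ /=.
  have [/andP[i0_gt0 _] _ _] := diag_gaps q_gt1 n_gt1 qn.
  have mE : mdeg q n n = (q ^ n.-1 * (1 + q ^ n))%N.
    by rewrite mdegE ?hn /= //; congr (q ^ _ * _)%N; lia.
  rewrite -mE subn_gt0 in i0_gt0.
  rewrite -subzn ?(ltnW i0_gt0) // !PoszX /mdeg.
  have -> : (2 * n - 1 - n = n - 1)%N by lia.
  by rewrite !PoszD; ring.
move=> q2 t2 n2; move: beta hF hbeta_uniq hbeta_roots @m @s @I @i0 @i1 @i2 @k1 @kt.
rewrite q2 n2 t2 => b cF b_uniq bP; cbv zeta.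
by rewrite (nz_indices_2_2_2 cF b_uniq bP).
Qed.
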